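(* Let $\omega=(\alpha,\beta,\delta)\in\Omega$, let $N\ge1$ and $a\in\{-1/2,1/2\}$. Then for every $\lambda=(\lambda_1\ge\dots\ge\lambda_N\ge0)\in\mathbb{J}_N$, \[ P^{\omega}_{N,a}(\lambda)=C_{N,a}\cdot\det\bigl[f_j^{(N,a)}(\lambda_i-i+N)\bigr]_{1\le i,j\le N}\cdot \dim_{SO(2N+1/2+a)}\lambda , \] where \[ f_j^{(N,a)}(k)=\frac{W^{(a,-1/2)}(k)}{\pi}\int_{-1}^1 x^{N-j}E^{\omega}(x)\,\mathsf{J}_k^{(a,-1/2)}(x)\,(1-x)^{a}(1+x)^{-1/2}\,dx \] and $C_{N,1/2}=2^{(N-1)N/2}$, $C_{N,-1/2}=2^{(N-2)(N-1)/2}$. (Here $SO(2N+1/2+a)$ means $SO(2N+1)$ for $a=1/2$ and $SO(2N)$ for $a=-1/2$.)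
   Context: Polynomials: for $s\in\mathbb{Z}_{\ge0}$ and $x=\cos\theta\in[-1,1]$ put $\mathsf{J}^{(-1/2,-1/2)}_s(\cos\theta)=\cos(s\theta)$ and $\mathsf{J}^{(1/2,-1/2)}_s(\cos\theta)=\sin((s+\tfrac12)\theta)/\sin(\theta/2)$ (these are Jacobi polynomials $J^{(a,-1/2)}_s$ divided by $c_s$, $c_0=1$, $c_s=\frac{1\cdot3\cdots(2s-1)}{2\cdot4\cdots(2s)}$); equivalently $\mathsf{J}_s^{(-1/2,-1/2)}(\frac{z+z^{-1}}2)=\frac{z^s+z^{-s}}2$, $\mathsf{J}_s^{(1/2,-1/2)}(\frac{z+z^{-1}}2)=\frac{z^{s+1/2}-z^{-s-1/2}}{z^{1/2}-z^{-1/2}}$. Weights: $W^{(-1/2,-1/2)}(0)=1$, $W^{(-1/2,-1/2)}(s)=2$ for $s>0$, $W^{(1/2,-1/2)}(s)=1$ for all $s\ge0$. Parameters: $\Omega$ is the set of triples $(\alpha,\beta,\delta)$ with $\alpha_1\ge\alpha_2\ge\dots\ge0$, $\beta_1\ge\beta_2\ge\dots\ge0$, $\delta\in\mathbb{R}$, $\sum_i(\alpha_i+\beta_i)\le\delta$; put $\gamma=\delta-\sum_i(\alpha_i+\beta_i)\ge0$ and \[E^{\omega}(x)=e^{\gamma(x-1)}\prod_{i\ge1}\frac{1-\beta_i(1-x)+\beta_i^2(1-x)/2}{1+\alpha_i(1-x)+\alpha_i^2(1-x)/2}.\] $\mathbb{J}_N$ is the set of integer sequences $\lambda_1\ge\dots\ge\lambda_N\ge0$.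 Dimensions: $\dim_{SO(2N+1)}\lambda=\prod_{i<j}\frac{l_i^2-l_j^2}{m_i^2-m_j^2}\prod_i\frac{l_i}{m_i}$ with $l_i=\lambda_i+N-i+\frac12$, $m_i=N-i+\frac12$; $\dim_{SO(2N)}\lambda=\prod_{i<j}\frac{l_i^2-l_j^2}{m_i^2-m_j^2}$ with $l_i=\lambda_i+N-i$, $m_i=N-i$. Characters: for $z_1,\dots,z_N$ on the unit circle, $\zeta_j=(z_j+z_j^{-1})/2$, $\chi^{\lambda}_{SO(2N+1)}(z)=\det[\mathsf{J}^{(1/2,-1/2)}_{\lambda_i-i+N}(\zeta_j)]/\det[(z_j+z_j^{-1})^{N-i}]$ (the irreducible character of $SO(2N+1)$ with highest weight $\lambda$ at an element with eigenvalues $z_j^{\pm1},1$), and $X^{\lambda}_{SO(2N)}(z):=(\chi^{\lambda}_{SO(2N)}+\chi^{\lambda^*}_{SO(2N)})(z)=\det[2\mathsf{J}^{(-1/2,-1/2)}_{\lambda_i-i+N}(\zeta_j)]/\det[(z_j+z_j^{-1})^{N-i}]$, where $\lambda^*=(\lambda_1,\dots,\lambda_{N-1},-\lambda_N)$ (these ratios are Laurent polynomials, extended by continuity). The probability measures $P^\omega_{N,1/2},P^\omega_{N,-1/2}$ on $\mathbb{J}_N$ are defined (via restriction of the extreme character $\chi^\omega$ of $O(\infty)$ to $SO(2N+1)$, resp. $SO(2N)$) by the identities, valid for all $z_j$ on the unit circle, \[\prod_{j=1}^N E^\omega(\zeta_j)=\sum_{\lambda\in\mathbb{J}_N}P^\omega_{N,1/2}(\lambda)\frac{\chi^\lambda_{SO(2N+1)}(z)}{\dim_{SO(2N+1)}\lambda}=\sum_{\lambda\in\mathbb{J}_N}P^\omega_{N,-1/2}(\lambda)\frac{X^\lambda_{SO(2N)}(z)}{2\dim_{SO(2N)}\lambda}.\]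 *)

(* Defs.v *)
From HB Require Import structures.
From mathcomp Require Import all_boot all_order all_algebra.
From mathcomp Require Import all_classical all_reals all_analysis.
Set Implicit Arguments. Unset Strict Implicit. Unset Printing Implicit Defensive.
Import Order.TTheory GRing.Theory Num.Theory.
Import numFieldNormedType.Exports.
Local Open Scope classical_set_scope.
Local Open Scope ring_scope.

Section Defs.
Variable R : realType.

Definition Jm (s : nat) (x : R) : R := cos (s%:R * acos x).
(* J^{(1/2,-1/2)}_s (cos t) = sin((s+1/2)t)/sin(t/2) = sum_{k=-s}^{s} z^k
   = 1 + 2 sum_{k=1}^{s} cos(k t)  (continuous at t = 0) *)
Definition Jp (s : nat) (x : R) : R :=
  1 + 2 * \sum_(1 <= k < s.+1) cos (k%:R * acos x).

Definition Jac (a : R) (s : nat) (x : R) : R :=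
  if a == 2^-1 then Jp s x else Jm s x.
Definition Wt (a : R) (s : nat) : R :=
  if a == 2^-1 then 1 else (if s == 0%N then 1 else 2).

Definition in_Omega (al be : nat -> R) (de : R) : Prop :=
  (forall i, 0 <= al i.+1 <= al i) /\ (forall i, 0 <= be i.+1 <= be i) /\
  (forall n, \sum_(i < n) (al i + be i) <= de).

Definition gam (al be : nat -> R) (de : R) : R :=
  de - limn (fun n => \sum_(i < n) (al i + be i)).

Definition Efun (al be : nat -> R) (de : R) (x : R) : R :=
  expR (gam al be de * (x - 1)) *
  limn (fun n => \prod_(i < n)
     ((1 - be i * (1 - x) + be i ^+ 2 * (1 - x) / 2) /
      (1 + al i * (1 - x) + al i ^+ 2 * (1 - x) / 2))).

(* signatures lambda in J_N : functions 'I_N -> nat, nonincreasing;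
   index i : 'I_N corresponds to 1-based index i+1 *)
Definition nonincr (N : nat) (lam : 'I_N -> nat) : bool :=
  [forall i : 'I_N, forall j : 'I_N, (i <= j)%N ==> (lam j <= lam i)%N].

(* lambda_i - i + N  (1-based i) *)
Definition shifted (N : nat) (lam : 'I_N -> nat) (i : 'I_N) : nat :=
  (lam i + (N - 1 - i))%N.

Definition dimSOodd (N : nat) (lam : 'I_N -> nat) : R :=
  let l i := (lam i)%:R + (N - i)%:R - 2^-1 in
  let m i := (N - i)%:R - 2^-1 in
  (\prod_(i < N) \prod_(j < N | (i < j)%N)
      ((l i ^+ 2 - l j ^+ 2) / (m i ^+ 2 - m j ^+ 2))) *
  \prod_(i < N) (l i / m i).

Definition dimSOeven (N : nat) (lam : 'I_N -> nat) : R :=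
  let l i := (lam i)%:R + (N - 1 - i)%:R in
  let m i := (N - 1 - i)%:R in
  \prod_(i < N) \prod_(j < N | (i < j)%N)
      ((l i ^+ 2 - l j ^+ 2) / (m i ^+ 2 - m j ^+ 2)).

Definition dimSO (a : R) (N : nat) (lam : 'I_N -> nat) : R :=
  if a == 2^-1 then dimSOodd lam else dimSOeven lam.

(* characters, as functions of zeta_j = (z_j + z_j^-1)/2 *)
Definition charden (N : nat) (ze : 'I_N -> R) : R :=
  \det (\matrix_(i < N, j < N) (2 * ze j) ^+ (N - 1 - i)).

Definition chiSOodd (N : nat) (lam : 'I_N -> nat) (ze : 'I_N -> R) : R :=
  \det (\matrix_(i < N, j < N) Jp (shifted lam i) (ze j)) / charden ze.

Definition XSOeven (N : nat) (lam : 'I_N -> nat) (ze : 'I_N -> R) : R :=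
  \det (\matrix_(i < N, j < N) (2 * Jm (shifted lam i) (ze j))) / charden ze.

Definition normchar (a : R) (N : nat) (lam : 'I_N -> nat) (ze : 'I_N -> R) : R :=
  if a == 2^-1 then chiSOodd lam ze / dimSOodd lam
  else XSOeven lam ze / (2 * dimSOeven lam).

Definition psum (N M : nat) (F : ('I_N -> nat) -> R) : R :=
  \sum_(l : {ffun 'I_N -> 'I_M.+1} | nonincr (fun i => nat_of_ord (l i)))
     F (fun i => nat_of_ord (l i)).

(* P is the probability measure P^omega_{N,a} on J_N, characterized by the
   defining identity (the series over J_N taken as limit of the partial
   sums over lambda_1 <= M; the series converges absolutely) *)
Definition is_P (a : R) (N : nat) (al be : nat -> R) (de : R)
  (P : ('I_N -> nat) -> R) : Prop :=
  (forall lam, nonincr lam -> 0 <= P lam) /\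
  (fun M => psum M P) @ \oo --> (1 : R) /\
  (forall ze : 'I_N -> R,
     (forall j, -1 <= ze j <= 1) -> injective ze ->
     (fun M => psum M (fun lam => P lam * normchar a lam ze)) @ \oo -->
       (\prod_(j < N) Efun al be de (ze j) : R)).

(* f_j^{(N,a)}(k), j : 'I_N is the 0-based index (1-based j+1) *)
Definition fj (a : R) (N : nat) (al be : nat -> R) (de : R) (j : 'I_N) (k : nat) : R :=
  Wt a k / pi *
  Rintegral lebesgue_measure [set` `[-1, 1]%classic]
    (fun x => x ^+ (N - 1 - j) * Efun al be de x * Jac a k x *
              powR (1 - x) a * powR (1 + x) (- 2^-1)).

Definition CNa (a : R) (N : nat) : R :=
  if a == 2^-1 then (2 ^ ((N.-1 * N) %/ 2))%:R
  else (2 ^ (((N - 2) * N.-1) %/ 2))%:R.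

End Defs.

(* Main.v *)
(** Multiplying the defining identity of P by the Vandermonde denominator turns
    it into
      sum_lam P(lam) k / dim(lam) det[J_{lam_i - i + N}(z_j)]
        = det[(2 z_j)^(N-i) E(z_j)],
    and P(lam) is then read off by integrating column j against J_{l_j} times
    the weight, since the J_k are orthogonal.  Only det J / dim <= C is needed
    to exchange sum and integral: the bound N! prod |J_{l_i}| on det J and the
    product formula for dim give it without appeal to |chi| <= dim.  Both sides of the
    identity vanish when two of the z_j coincide, so it holds on all of
    [-1, 1]^N, and the integrations can be done one column at a time.  With
    x = cos t both weights are polynomial multiples of (1 - x^2)^(-1/2) dx =
    dt, which gives the orthogonality. *)
Require Import Defs.
From HB Require Import structures.
From mathcomp Require Import all_boot all_order all_algebra fingroup perm.
From mathcomp Require Import all_classical all_reals all_analysis.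
From mathcomp Require Import measurable_realfun ring lra zify.
Import Order.TTheory GRing.Theory Num.Theory.
Import numFieldNormedType.Exports.
Local Open Scope ring_scope.
Set Implicit Arguments. Unset Strict Implicit. Unset Printing Implicit Defensive.

(** * Integration against (1 - x^2)^(-1/2) on [-1, 1] *)
Section ArcsineIntegral.
Context {R : realType}.
Implicit Types (p P : R -> R) (x : R).
Local Open Scope classical_set_scope.

(** At -1 and 1 the square root vanishes and its inverse is 0 by convention, so the weight is total
    and nonnegative. *)
Definition arcsine_weight x : R := (Num.sqrt (1 - x ^+ 2))^-1.

Lemma continuous_arcsine_comp p x : continuous p -> -1 < x < 1 ->
  {for x, continuous (fun x => p (acos x) * arcsine_weight x)}.
Proof.
move=> cp xI; have [x1 x2] := andP xI; apply: cvgM.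
  apply: continuous_comp; [exact: continuous_acos|exact: cp].
have s0 : Num.sqrt (1 - x ^+ 2) != 0.
  by rewrite gt_eqF// sqrtr_gt0; nra.
apply: cvgV => //; apply: (@continuous_comp _ _ _ (fun x => 1 - x ^+ 2)).
  by apply: cvgB; [exact: cvg_cst|exact: exprn_continuous].
exact: sqrt_continuous.
Qed.

Lemma measurable_acos : measurable_fun `[(-1 : R), 1] (@acos R).
Proof.
apply: (@measurable_fun_itv_cc _ _ _ false true).
apply: open_continuous_measurable_fun; first exact: interval_open.
by move=> x; rewrite inE/= in_itv/=; exact: continuous_acos.
Qed.

Lemma measurable_arcsine_weight : measurable_fun `[(-1 : R), 1] arcsine_weight.
Proof.
apply: (@measurable_fun_itv_cc _ _ _ false true).
apply: open_continuous_measurable_fun; first exact: interval_open.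
move=> x; rewrite inE/= in_itv/= => xI.
have c1 : continuous (fun _ : R => 1 : R) by exact: cst_continuous.
rewrite (_ : arcsine_weight = fun x => 1 * arcsine_weight x).
  exact: continuous_arcsine_comp c1 xI.
by apply/funext => y; rewrite mul1r.
Qed.

(** The derivative of [acos] is minus the weight, so [- P (acos x)] is an antiderivative. The
    condition on [e] keeps the segment nondegenerate and inside the open interval, where [acos] is
    differentiable. *)
Lemma arcsine_FTC_segment p P (e : R) :
  continuous p -> (forall t : R, is_derive t 1 P (p t)) -> 0 < e < pi / 2 ->
  (\int[lebesgue_measure]_(x in `[cos (pi - e), cos e])
     (p (acos x) * arcsine_weight x)%:E = (P (pi - e) - P e)%:E)%E.
Proof.
move=> cp dP /andP[e0 e1]; have pi0 := pi_gt0 R.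
have He : e \in `[0, (pi : R)]%R by rewrite in_itv/=; apply/andP; split; lra.
have Hpe : pi - e \in `[0, (pi : R)]%R by rewrite in_itv/=; apply/andP; split; lra.
have H0 : 0 \in `[0, (pi : R)]%R by rewrite in_itv/= lexx ltW.
have Hpi : (pi : R) \in `[0, (pi : R)]%R by rewrite in_itv/= lexx ltW.
have lo : -1 < cos (pi - e) by rewrite -cospi ltr_cos//; lra.
have hi : cos e < 1 by rewrite -cos0 ltr_cos.
have lohi : cos (pi - e) < cos e by rewrite ltr_cos//; lra.
have sub x : x \in `[cos (pi - e), cos e]%R -> -1 < x < 1.
  by rewrite in_itv/= => /andP[xl xr]; rewrite (lt_le_trans lo xl) (le_lt_trans xr hi).
have dF x : -1 < x < 1 ->
    is_derive x 1 (fun x => - P (acos x)) (p (acos x) * arcsine_weight x).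
  move=> xI; have dc := is_derive1_acos xI.
  have := is_derive1_comp (dP (acos x)) dc.
  move=> /is_deriveN; rewrite mulrN opprK; exact.
have cF x : -1 < x < 1 -> {for x, continuous (fun x => - P (acos x))}.
  move=> xI; apply/differentiable_continuous/derivable1_diffP.
  by have [] := dF x xI.
rewrite (@continuous_FTC2 _ _ (fun x => - P (acos x)))//.
- by rewrite !cosK// -EFinB; congr EFin; ring.
- apply: continuous_subspace_itv => x xI; apply: continuous_arcsine_comp => //.
  exact: sub.
- split.
  + by move=> x xI; have [] := dF x (sub _ (subset_itv_oo_cc xI)).
  + by apply: cvg_at_right_filter; apply: cF; apply: sub; rewrite bound_itvE ltW.
  + by apply: cvg_at_left_filter; apply: cF; apply: sub; rewrite bound_itvE ltW.
- move=> x xI; rewrite derive1E.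
  by have [] := dF x (sub _ (subset_itv_oo_cc xI)).
Qed.

(* The weight is unbounded at -1 and 1, so the substitution x = cos t is
   carried out on [cos (pi - e), cos e] and e is sent to 0. *)
Lemma ge0_arcsine_FTC p P :
  continuous p -> (forall t : R, is_derive t 1 P (p t)) -> (forall t, 0 <= p t) ->
  (\int[lebesgue_measure]_(x in `[(-1)%R, 1%R])
     (p (acos x) * arcsine_weight x)%:E = (P pi - P 0)%:E)%E.
Proof.
move=> cp dP p0; have pi0 := pi_gt0 R.
(* Starting at [pi / 4] makes [e n < pi / 2] hold already for n = 0. *)
pose e (n : nat) : R := (pi / 4) * n.+1%:R^-1.
have e_itv n : 0 < e n < pi / 2.
  have : (n.+1%:R : R)^-1 <= 1 by rewrite invf_le1// ler1n.
  have : 0 < (n.+1%:R : R)^-1 by rewrite invr_gt0.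
  rewrite /e; move: (n.+1%:R^-1) => v v0 v1; rewrite mulr_gt0 ?divr_gt0//=.
  by apply: (@le_lt_trans _ _ (pi / 4)); [rewrite ler_piMr// divr_ge0// ltW|lra].
have e_dec m n : (m <= n)%N -> e n <= e m.
  by move=> mn; rewrite /e ler_pM2l ?divr_gt0// lef_pV2 ?posrE// ler_nat ltnS.
have in0pi t : 0 <= t <= pi -> t \in `[0, (pi : R)]%R by rewrite in_itv.
have zP : 0 \in `[0, (pi : R)]%R by rewrite in_itv/= lexx ltW.
have piP : (pi : R) \in `[0, (pi : R)]%R by rewrite in_itv/= lexx ltW.
have le_cos (t u : R) : t \in `[0, (pi : R)]%R -> u \in `[0, (pi : R)]%R ->
    t <= u -> cos u <= cos t.
  by move=> ht hu tu; rewrite leNgt ltr_cos// -leNgt.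
have eP n : e n \in `[0, (pi : R)]%R.
  by apply: in0pi; have /andP[? ?] := e_itv n; apply/andP; split; lra.
have peP n : pi - e n \in `[0, (pi : R)]%R.
  by apply: in0pi; have /andP[? ?] := e_itv n; apply/andP; split; lra.
have e_cvg : e @ \oo --> (0 : R).
  rewrite -(mulr0 (pi / 4)); apply: cvgM; [exact: cvg_cst|exact: cvg_harmonic].
pose F n := `[cos (pi - e n), cos (e n)]%classic : set R.
have sub n x : F n x -> -1 < x < 1.
  rewrite /F/= in_itv/= => /andP[xl xr]; have /andP[? ?] := e_itv n.
  apply/andP; split.
    by apply: lt_le_trans xl; rewrite -cospi ltr_cos//; lra.
  by apply: le_lt_trans xr _; rewrite -cos0 ltr_cos.
have FU : \bigcup_n F n = `](-1)%R, 1%R[.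
  apply/seteqP; split=> [x [n _ /sub]|x]; rewrite /= in_itv//=.
  move=> xI; have /andP[x1 x2] := xI.
  have a0 : 0 < acos x by rewrite acos_gt0 // ltW.
  have api : acos x < pi by rewrite acos_ltpi // x1 ltW.
  have acI : acos x \in `[0, (pi : R)]%R by rewrite in0pi// !ltW.
  have cx : cos (acos x) = x by rewrite acosK// in_itv/= !ltW.
  (* Once [e n] is below the distance from [acos x] to both 0 and [pi], the segment [F n] contains
     x. *)
  have [n _ Hn] : \forall n \near \oo, e n < Num.min (acos x) (pi - acos x).
    have m0 : 0 < Num.min (acos x) (pi - acos x) by rewrite lt_min a0 subr_gt0.
    exact: (cvgr_lt _ e_cvg _ m0).
  have := Hn n (leqnn n); rewrite lt_min => /andP[h1 h2].
  exists n => //; rewrite /F/= in_itv/= -cx.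
  by apply/andP; split; apply: le_cos => //; lra.
have mp : measurable_fun `](-1 : R), (1 : R)[ (fun x => (p (acos x) * arcsine_weight x)%:E).
  apply/measurable_EFinP; apply: open_continuous_measurable_fun.
    exact: interval_open.
  by move=> x; rewrite inE/= in_itv/=; exact: continuous_arcsine_comp.
(* The endpoints are negligible, and the segments [F n] exhaust the open interval. As p is
   nonnegative, monotone convergence identifies the limit. *)
rewrite integral_itv_bndoo// -FU.
have Fcvg : (\int[lebesgue_measure]_(x in F n)
    (p (acos x) * arcsine_weight x)%:E)%E @[n --> \oo] --> (P pi - P 0)%:E.
  rewrite (_ : (fun n => _) = fun n => (P (pi - e n) - P (e n))%:E); last first.
    by apply/funext => n; exact: arcsine_FTC_segment.
  have cP : continuous P.
    move=> t; apply/differentiable_continuous/derivable1_diffP.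
    by have [] := dP t.
  have pe_cvg : (fun n => pi - e n) @ \oo --> (pi : R).
    by rewrite -[X in _ --> X]subr0; apply: cvgB => //; exact: cvg_cst.
  have Pcvg : (fun n => P (pi - e n) - P (e n)) @ \oo --> P pi - P 0.
    apply: cvgB; first by exact: (cvg_comp _ _ pe_cvg (cP _)).
    by exact: (cvg_comp _ _ e_cvg (cP _)).
  by apply: cvg_EFin; first near=> n.
apply: (cvg_unique _ _ Fcvg) => //.
apply: ge0_nondecreasing_set_cvg_integral.
- move=> m n mn; rewrite subsetEset; apply: subset_itv; rewrite bnd_simp le_cos//.
    by rewrite lerB// e_dec.
  exact: e_dec.
- by move=> n; exact: measurable_itv.
- move=> n; apply: measurable_funS mp => //.
  by rewrite -FU; exact: bigcup_sup.
- by move=> n x _; rewrite lee_fin mulr_ge0// invr_ge0 sqrtr_ge0.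
Unshelve. all: by end_near. Qed.

End ArcsineIntegral.

(** * Bounded measurable functions on [-1, 1] and their arcsine integrals *)

Section BoundedMeasurable.
Context {R : realType}.
Implicit Types (f g : R -> R).
Local Open Scope classical_set_scope.
Local Notation I := (`[(-1 : R)%R, (1 : R)%R]).

(** A class closed under sums and products whose members are all integrable against the weight, so
    that integrability follows from the shape of an expression. *)
Definition bmeas f := measurable_fun I f /\
  exists K, forall x, -1 <= x <= 1 -> `|f x| <= K.

Lemma bmeas_cst (c : R) : bmeas (fun=> c).
Proof. by split; [exact: measurable_cst|exists `|c|]. Qed.

Lemma bmeas_id : bmeas id.
Proof.
split; first exact: measurable_id.
by exists 1 => x; rewrite ler_norml.
Qed.

Lemma bmeasD f g : bmeas f -> bmeas g -> bmeas (fun x => f x + g x).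
Proof.
move=> [mf [K fK]] [mg [L gL]]; split; first exact: measurable_funD.
by exists (K + L) => x xI; rewrite (le_trans (ler_normD _ _))// lerD ?fK ?gL.
Qed.

Lemma bmeasM f g : bmeas f -> bmeas g -> bmeas (fun x => f x * g x).
Proof.
move=> [mf [K fK]] [mg [L gL]]; split; first exact: measurable_funM.
by exists (K * L) => x xI; rewrite normrM ler_pM ?fK ?gL.
Qed.

Lemma bmeasX f n : bmeas f -> bmeas (fun x => f x ^+ n).
Proof.
move=> bf; elim: n => [|n ih].
  by under eq_fun do rewrite expr0; exact: bmeas_cst.
by under eq_fun do rewrite exprS; exact: bmeasM.
Qed.

Lemma bmeas_sum (J : Type) (s : seq J) (P : pred J) (F : J -> R -> R) :
  (forall i, bmeas (F i)) -> bmeas (fun x => \sum_(i <- s | P i) F i x).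
Proof.
move=> bF; elim: s => [|i s ih].
  by under eq_fun do rewrite big_nil; exact: bmeas_cst.
under eq_fun do rewrite big_cons; case: (P i) => //; exact: bmeasD.
Qed.

Lemma bmeas_comp_acos f : continuous f -> (exists K, forall t, `|f t| <= K) ->
  bmeas (fun x => f (acos x)).
Proof.
move=> cf [K fK]; split; last by exists K.
apply: (@measurableT_comp _ _ _ _ _ _ f); last exact: measurable_acos.
exact: continuous_measurable_fun.
Qed.

Lemma bmeas_cos (m : R) : bmeas (fun x => cos (m * acos x)).
Proof.
apply: (@bmeas_comp_acos (fun t => cos (m * t))).
  move=> t; apply: continuous_comp; last exact: continuous_cos.
  by apply: cvgM; [exact: cvg_cst|exact: cvg_id].
by exists 1 => t; rewrite ler_norml cos_geN1 cos_le1.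
Qed.

Lemma bmeas_Jm s : bmeas (Jm s).
Proof. exact: bmeas_cos. Qed.

Lemma bmeas_Jp s : bmeas (Jp s).
Proof.
apply: bmeasD; first exact: bmeas_cst.
apply: bmeasM; first exact: bmeas_cst.
by apply: bmeas_sum => k; exact: bmeas_Jm.
Qed.

(** The substitution formula with p = 1 and P the identity gives the finite value [pi]. *)
Lemma integrable_arcsine_weight :
  lebesgue_measure.-integrable I (EFin \o (@arcsine_weight R)).
Proof.
apply/integrableP; split.
  by apply/measurable_EFinP; exact: measurable_arcsine_weight.
under eq_integral => x _.
  rewrite /= ger0_norm ?invr_ge0 ?sqrtr_ge0// -[arcsine_weight x]mul1r.
  over.
rewrite (@ge0_arcsine_FTC _ (fun=> 1) id) ?ltry//.
exact: cst_continuous.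
Qed.

Lemma integrable_bmeas f : bmeas f ->
  lebesgue_measure.-integrable I (EFin \o (fun x => f x * arcsine_weight x)).
Proof.
move=> [mf [K fK]].
have -> : EFin \o (fun x => f x * arcsine_weight x) =
    ((EFin \o f) \* (EFin \o (@arcsine_weight R)))%E by apply/funext.
apply: integrableMr => //; last exact: integrable_arcsine_weight.
exists K; split; first exact: num_real.
move=> M KM x; rewrite /= in_itv/= => xI; exact: le_trans (fK x xI) (ltW KM).
Qed.

Definition arcsine_integral f : R :=
  (\int[lebesgue_measure]_(x in I) (f x * arcsine_weight x))%R.

Lemma arcsine_integralD f g : bmeas f -> bmeas g ->
  arcsine_integral (fun x => f x + g x) = arcsine_integral f + arcsine_integral g.
Proof.
move=> bf bg; rewrite /arcsine_integral -RintegralD//.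
- by apply: eq_Rintegral => x _; rewrite mulrDl.
- exact: integrable_bmeas.
- exact: integrable_bmeas.
Qed.

Lemma arcsine_integralZ (c : R) f : bmeas f ->
  arcsine_integral (fun x => c * f x) = c * arcsine_integral f.
Proof.
move=> bf; rewrite /arcsine_integral -RintegralZl//.
- by apply: eq_Rintegral => x _; rewrite mulrA.
- exact: integrable_bmeas.
Qed.

Lemma arcsine_integral_sum (J : Type) (s : seq J) (P : pred J)
    (F : J -> R -> R) : (forall i, bmeas (F i)) ->
  arcsine_integral (fun x => \sum_(i <- s | P i) F i x) =
  \sum_(i <- s | P i) arcsine_integral (F i).
Proof.
move=> bF; elim: s => [|i s ih].
  under [X in arcsine_integral X]eq_fun do rewrite big_nil.
  have := @arcsine_integralZ 0 _ (bmeas_cst 0).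
  by rewrite mul0r mul0r big_nil.
under [X in arcsine_integral X]eq_fun do rewrite big_cons.
rewrite big_cons; case: (P i) => //; rewrite arcsine_integralD ?ih//.
exact: bmeas_sum.
Qed.

Lemma eq_arcsine_integral f g : (forall x, -1 <= x <= 1 -> f x = g x) ->
  arcsine_integral f = arcsine_integral g.
Proof.
move=> fg; apply: eq_Rintegral => x; rewrite inE/= in_itv/= => xI.
by rewrite fg.
Qed.

(** Dominated convergence with majorant [K] times the weight. *)
Lemma arcsine_integral_cvg (F : nat -> R -> R) f (K : R) :
  (forall n, bmeas (F n)) -> bmeas f ->
  (forall x, -1 <= x <= 1 -> F ^~ x @ \oo --> f x) ->
  (forall n x, -1 <= x <= 1 -> `|F n x| <= K) ->
  arcsine_integral (F n) @[n --> \oo] --> arcsine_integral f.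
Proof.
move=> bF bf Ff FK.
pose w := @arcsine_weight R.
have w0 x : 0 <= w x by rewrite invr_ge0 sqrtr_ge0.
have ae_cvg : \forall x \ae lebesgue_measure, I x ->
    (fun n => (F n x * w x)%:E) @ \oo --> (f x * w x)%:E.
  apply: aeW => x; rewrite /= in_itv/= => xI; apply: cvg_EFin; first by near=> n.
  by apply: cvgM; [exact: Ff|exact: cvg_cst].
have ae_le : \forall x \ae lebesgue_measure, forall n, I x ->
    (`|(F n x * w x)%:E| <= (K * w x)%:E)%E.
  apply: aeW => x n; rewrite /= in_itv/= => xI.
  by rewrite lee_fin normrM (ger0_norm (w0 x)) ler_wpM2r// FK.
have [intf _ cvg_int] := @dominated_convergence _ _ R lebesgue_measure I
  (measurable_itv `[(-1 : R), 1]%R)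
  (fun n x => (F n x * w x)%:E) (fun x => (f x * w x)%:E) (fun x => (K * w x)%:E)
  (fun n => measurable_int _ (integrable_bmeas (bF n)))
  (measurable_int _ (integrable_bmeas bf)) ae_cvg
  (integrable_bmeas (bmeas_cst K)) ae_le.
apply: fine_cvg; rewrite fineK//; exact: integrable_fin_num.
Unshelve. all: by end_near. Qed.

Lemma ge0_arcsine_integral_acos (p P : R -> R) :
  continuous p -> (forall t : R, is_derive t 1 P (p t)) -> (forall t, 0 <= p t) ->
  arcsine_integral (fun x => p (acos x)) = P pi - P 0.
Proof.
by move=> cp dP p0; rewrite /arcsine_integral /Rintegral (@ge0_arcsine_FTC _ p P).
Qed.

Lemma arcsine_integral1 : arcsine_integral (fun=> 1) = pi.
Proof.
by rewrite (@ge0_arcsine_integral_acos (fun=> 1) id) ?subr0//; exact: cst_continuous.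
Qed.

(** The substitution formula asks for a nonnegative integrand, so it is applied to 1 + cos(m t),
    whose integral is [pi]; the integral of 1 is then subtracted. *)
Lemma arcsine_integral_cos (m : R) : m != 0 -> sin (m * pi) = 0 ->
  arcsine_integral (fun x => cos (m * acos x)) = 0.
Proof.
move=> m0 sm.
have cm : continuous (fun t : R => cos (m * t)).
  move=> t; apply: continuous_comp; last exact: continuous_cos.
  by apply: cvgM; [exact: cvg_cst|exact: cvg_id].
have dm (t : R) : is_derive t 1 (fun t => t + m^-1 * sin (m * t)) (1 + cos (m * t)).
  apply: is_deriveD.
  rewrite (_ : cos (m * t) = m^-1 *: (cos (m * t) * m)); last first.
    by rewrite /GRing.scale/= mulrCA mulVf// mulr1.
  apply: (@is_deriveZ _ _ _ (fun t => sin (m * t))).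
  apply: (@is_derive1_comp _ sin (fun t => m * t)).
  rewrite -[X in is_derive _ _ _ X]mulr1.
  exact: is_deriveZ.
have := @ge0_arcsine_integral_acos _ _ _ dm _.
rewrite arcsine_integralD; last 2 first.
- exact: bmeas_cst.
- exact: bmeas_cos.
rewrite arcsine_integral1 sm mulr0 mulr0 sin0 mulr0 addr0 addr0 subr0.
move=> /(_ _ _) h.
apply: (@addrI _ pi); rewrite addr0; apply: h.
  by move=> t; apply: cvgD; [exact: cvg_cst|exact: cm].
by move=> t; rewrite -lerBlDl sub0r cos_geN1.
Qed.

End BoundedMeasurable.

(** * Orthogonality of the J_k *)
Section Orthogonality.
Context {R : realType}.
Implicit Types (t x : R).

Lemma sin_natmul_pi n : sin (n%:R * pi) = 0 :> R.
Proof.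
elim: n => [|n ih]; first by rewrite mul0r sin0.
by rewrite mulrS mulrDl mul1r addrC sinDpi ih oppr0.
Qed.

Lemma sin_natmulB_pi k l : sin ((k%:R - l%:R) * pi) = 0 :> R.
Proof. by rewrite mulrBl sinB !sin_natmul_pi mul0r mulr0 subrr. Qed.

Lemma arcsine_integral_cosB k l :
  arcsine_integral (fun x : R => cos ((k%:R - l%:R) * acos x)) =
  (k == l)%:R * pi.
Proof.
have [->|kl] := eqVneq k l.
  under [X in arcsine_integral X]eq_fun do rewrite subrr mul0r cos0.
  by rewrite arcsine_integral1 mul1r.
by rewrite arcsine_integral_cos ?mul0r ?sin_natmulB_pi// subr_eq0 eqr_nat.
Qed.

(** The second frequency is written as a difference with [0%:R] so that [arcsine_integral_cosB]
    evaluates both terms. *)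
Lemma JmM k l x : Jm k x * Jm l x =
  2^-1 * (cos ((k%:R - l%:R) * acos x) + cos (((k + l)%:R - 0%:R) * acos x)).
Proof.
by rewrite /Jm subr0 natrD mulrBl mulrDl cosB cosD; field.
Qed.

(** The Dirichlet kernel identity, by induction on s. Kept free of division, it links the cosine sum
    defining [Jp] to sin((s + 1/2) t) even where sin(t / 2) = 0. *)
Lemma sin_half_Jp s t : sin (t / 2) * (1 + 2 * \sum_(1 <= k < s.+1) cos (k%:R * t)) =
  sin (s%:R * t + t / 2).
Proof.
elim: s => [|s ih]; first by rewrite big_geq// mulr0 addr0 mulr1 mul0r add0r.
rewrite big_nat_recr//=; set S := \sum_(_ <= _ < _) _ in ih *.
have -> : sin (t / 2) * (1 + 2 * (S + cos (s.+1%:R * t))) =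
    sin (t / 2) * (1 + 2 * S) + 2 * sin (t / 2) * cos (s.+1%:R * t) by ring.
rewrite ih; have -> : s%:R * t + t / 2 = s.+1%:R * t - t / 2.
  by rewrite -natr1; field.
by rewrite sinB sinD; ring.
Qed.

(** With x = cos t, the factor 1 - x is 2 sin(t/2)^2, which supplies one sine to each Dirichlet
    kernel; a product of two sines remains. *)
Lemma JpM k l x : -1 <= x <= 1 -> Jp k x * (Jp l x * (1 - x)) =
  cos ((k%:R - l%:R) * acos x) - cos (((k + l).+1%:R - 0%:R) * acos x).
Proof.
move=> xI; rewrite /Jp; set t := acos x.
have xE : x = cos t by rewrite acosK// in_itv.
have -> : 1 - x = 2 * (sin (t / 2) * sin (t / 2)).
  rewrite {1}xE (_ : t = t / 2 + t / 2) ?cosD; last by field.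
  have := cos2Dsin2 (t / 2); set c := cos _; set s := sin _; rewrite !expr2 => cs.
  have -> : (t / 2 + t / 2) / 2 = t / 2 by field.
  by rewrite -/s; lra.
set A := 1 + _; set B := 1 + _.
have -> : A * (B * (2 * (sin (t / 2) * sin (t / 2)))) =
    2 * (sin (t / 2) * A) * (sin (t / 2) * B) by ring.
rewrite !sin_half_Jp.
have -> : (k%:R - l%:R) * t = (k%:R * t + t / 2) - (l%:R * t + t / 2) by ring.
have -> : ((k + l).+1%:R - 0%:R) * t = (k%:R * t + t / 2) + (l%:R * t + t / 2).
  by rewrite -natr1 natrD; field.
by rewrite (cosB (_ + _)) (cosD (_ + t / 2) (_ + t / 2)); ring.
Qed.

(** The polynomial left when the arcsine weight is factored out of the Jacobi weight. *)
Definition weight_poly (a x : R) : R := if a == 2^-1 then 1 - x else 1.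

Lemma bmeas_weight_poly a : bmeas (weight_poly a).
Proof.
rewrite /weight_poly; case: (a == _); last exact: bmeas_cst.
have -> : (fun x : R => 1 - x) = (fun x => 1 + -1 * x).
  by apply/funext => x; rewrite mulN1r.
apply: bmeasD; first exact: bmeas_cst.
by apply: bmeasM; [exact: bmeas_cst|exact: bmeas_id].
Qed.

Lemma bmeas_Jac a s : bmeas (@Jac R a s).
Proof. by rewrite /Jac; case: (a == _); [exact: bmeas_Jp|exact: bmeas_Jm]. Qed.

(** For a = 1/2 the second frequency k + l + 1 is never 0. Otherwise it is k + l, which vanishes
    only for k = l = 0; the smaller value of [Wt] at 0 compensates for that extra contribution. *)
Lemma Jac_orthonormal (a : R) k l : arcsine_integral
    (fun x => Jac a k x * (Wt a l / pi * (Jac a l x * weight_poly a x))) =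
  (k == l)%:R.
Proof.
have pi0 : (pi : R) != 0 by rewrite gt_eqF// pi_gt0.
rewrite (@eq_arcsine_integral _ _ (fun x => Wt a l / pi *
  (Jac a k x * (Jac a l x * weight_poly a x)))); last first.
  by move=> x _; rewrite mulrCA.
rewrite arcsine_integralZ; last first.
  by do 2 (apply: bmeasM; first exact: bmeas_Jac); exact: bmeas_weight_poly.
rewrite /Wt /Jac /weight_poly; case: (a == _).
  rewrite (@eq_arcsine_integral _ _ (fun x => cos ((k%:R - l%:R) * acos x) +
    -1 * cos (((k + l).+1%:R - 0%:R) * acos x))); last first.
    by move=> x xI; rewrite JpM// mulN1r.
  rewrite arcsine_integralD; last 2 first.
  - exact: bmeas_cos.
  - by apply: bmeasM; [exact: bmeas_cst|exact: bmeas_cos].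
  rewrite arcsine_integralZ; last exact: bmeas_cos.
  rewrite !arcsine_integral_cosB.
  rewrite (_ : ((k + l).+1 == 0%N) = false)//.
  rewrite mul0r mulr0 addr0 mul1r mulrCA mulVf ?mulr1//.
rewrite (@eq_arcsine_integral _ _ (fun x => 2^-1 * (cos ((k%:R - l%:R) * acos x) +
  cos (((k + l)%:R - 0%:R) * acos x)))); last first.
  by move=> x xI; rewrite mulr1 JmM.
rewrite arcsine_integralZ; last by apply: bmeasD; exact: bmeas_cos.
rewrite arcsine_integralD; [|exact: bmeas_cos|exact: bmeas_cos].
rewrite !arcsine_integral_cosB addn_eq0.
have [->|kl] := eqVneq k l.
  move: (pi : R) pi0 => p p0.
  by case: (l == 0%N) => /=; rewrite ?mulr1n ?mulr0n ?mul1r ?mul0r ?addr0; field.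
have -> : (k == 0%N) && (l == 0%N) = false.
  by apply/negP => /andP[/eqP k0 /eqP l0]; move: kl; rewrite k0 l0.
by rewrite /= mul0r addr0 !mulr0.
Qed.

(** The endpoints are included: there a negative power of 0 and the inverse of 0 are both 0. *)
Lemma weight_polyE (a x : R) : a = 2^-1 \/ a = - 2^-1 -> -1 <= x <= 1 ->
  powR (1 - x) a * powR (1 + x) (- 2^-1) = weight_poly a x * arcsine_weight x.
Proof.
move=> ha /andP[x1 x2]; have x1' : 0 <= 1 - x by rewrite subr_ge0.
have x2' : 0 <= 1 + x by rewrite -lerBlDl sub0r.
rewrite /weight_poly /arcsine_weight.
have -> : 1 - x ^+ 2 = (1 - x) * (1 + x) by ring.
rewrite sqrtrM// invfM powRN powR12_sqrt//.
case: ha => ->; first rewrite eqxx powR12_sqrt//.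
  rewrite mulrA; congr (_ * _).
  have [->|x0] := eqVneq (1 - x) 0; first by rewrite sqrtr0 mul0r.
  rewrite -{2}(sqr_sqrtr x1') expr2 mulfK// gt_eqF// sqrtr_gt0.
  by rewrite lt_neqAle eq_sym x0.
rewrite powRN powR12_sqrt// ifF ?mul1r//.
by apply/negbTE; rewrite lt_eqF//; lra.
Qed.

Lemma Jac_le (a x : R) s : `|Jac a s x| <= (if a == 2^-1 then (2 * s + 1)%:R else 1).
Proof.
have cos1 t : `|cos t| <= 1 :> R by rewrite ler_norml cos_geN1 cos_le1.
rewrite /Jac; case: ifP => _; last exact: cos1.
rewrite /Jp natrD addrC (le_trans (ler_normD _ _))// normr1 lerD2r.
rewrite normrM normr_nat natrM ler_pM2l//.
rewrite (le_trans (ler_norm_sum _ _ _))//.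
rewrite (le_trans (ler_sum _ (fun k _ => cos1 _)))//.
by rewrite sumr_const_nat subSS subn0.
Qed.

End Orthogonality.

(** * Boundedness and measurability of E *)
Section Efun_bmeas.
Context {R : realType} (al be : nat -> R) (de : R).
Hypothesis omega : in_Omega al be de.
Implicit Types x : R.
Local Open Scope classical_set_scope.

Let Efactor i x := (1 - be i * (1 - x) + be i ^+ 2 * (1 - x) / 2) /
  (1 + al i * (1 - x) + al i ^+ 2 * (1 - x) / 2).

Let al_ge0 i : 0 <= al i.
Proof. by case: omega => /(_ i)/andP[h1 h2] _; exact: le_trans h1 h2. Qed.

Let be_ge0 i : 0 <= be i.
Proof. by case: omega => _ [/(_ i)/andP[h1 h2] _]; exact: le_trans h1 h2. Qed.

Let be_dec m n : (m <= n)%N -> be n <= be m.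
Proof.
have h : nonincreasing_seq be.
  by apply/nonincreasing_seqP => k; case: omega => _ [/(_ k)/andP[]].
exact: h.
Qed.

Let den_ge1 i x : -1 <= x <= 1 -> 1 <= 1 + al i * (1 - x) + al i ^+ 2 * (1 - x) / 2.
Proof.
move=> /andP[x1 x2]; rewrite -addrA lerDl addr_ge0// ?mulr_ge0 ?invr_ge0 ?exprn_ge0//.
- by rewrite subr_ge0.
- by rewrite subr_ge0.
Qed.

(** The numerator is a convex combination of the squares 1 and [(1 - be i) ^+ 2], with weights (1 +
    x)/2 and (1 - x)/2. *)
Let num_ge0 i x : -1 <= x <= 1 -> 0 <= 1 - be i * (1 - x) + be i ^+ 2 * (1 - x) / 2.
Proof.
move=> /andP[x1 x2].
have -> : 1 - be i * (1 - x) + be i ^+ 2 * (1 - x) / 2 =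
   (1 + x) / 2 + (1 - x) / 2 * (1 - be i) ^+ 2 by field.
rewrite addr_ge0//; first lra.
by rewrite mulr_ge0 ?sqr_ge0//; lra.
Qed.

Let Efactor_ge0 i x : -1 <= x <= 1 -> 0 <= Efactor i x.
Proof.
move=> xI; rewrite divr_ge0 ?num_ge0//; exact: le_trans ler01 (den_ge1 i xI).
Qed.

Let Efactor_le_num i x : -1 <= x <= 1 ->
  Efactor i x <= 1 - be i * (1 - x) + be i ^+ 2 * (1 - x) / 2.
Proof.
move=> xI; have d1 := den_ge1 i xI.
by rewrite ler_pdivrMr ?(lt_le_trans ltr01)// ler_peMr// num_ge0.
Qed.

(** A crude bound, uniform in i, meant for the finitely many factors with [be i > 2]. *)
Let Efactor_le i x : -1 <= x <= 1 -> Efactor i x <= 1 + be 0%N ^+ 2.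
Proof.
move=> xI; apply: le_trans (Efactor_le_num i xI) _.
have b0 := be_ge0 i; have /andP[x1 x2] := xI.
have b2 : be i ^+ 2 <= be 0%N ^+ 2 by rewrite lerXn2r ?nnegrE ?be_ge0 ?be_dec.
apply: (@le_trans _ _ (1 + be i ^+ 2)); last by rewrite lerD2l.
have : 0 <= be i ^+ 2 by exact: sqr_ge0.
have : 0 <= be i * (1 - x) by rewrite mulr_ge0// subr_ge0.
by move: (be i ^+ 2) => c; nra.
Qed.

Let Efactor_le1 i x : be i <= 2 -> -1 <= x <= 1 -> Efactor i x <= 1.
Proof.
move=> b2 xI; apply: le_trans (Efactor_le_num i xI) _.
have b0 := be_ge0 i; have /andP[x1 x2] := xI.
have -> : 1 - be i * (1 - x) + be i ^+ 2 * (1 - x) / 2 =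
  1 - (1 - x) * (be i * (2 - be i)) / 2 by field.
by rewrite gerBl divr_ge0// !mulr_ge0// subr_ge0.
Qed.

(* i * be i is at most the i-th partial sum, hence at most de; a factor with
   be i <= 2 is at most 1, so the partial products eventually decrease. *)
Let be_le2 : exists n0, forall i, (n0 <= i)%N -> be i <= 2.
Proof.
exists (Num.truncn `|de|).+1 => i ni; rewrite leNgt; apply/negP => b2.
have [_ [_ /(_ i)]] := omega; apply/negP; rewrite -ltNge.
have : de < i%:R.
  apply: (le_lt_trans (ler_norm _)).
  by apply: lt_le_trans (truncnS_gt _) _; rewrite ler_nat.
move=> /lt_le_trans; apply.
have -> : i%:R = \sum_(k < i) (1 : R) by rewrite sumr_const card_ord.
apply: ler_sum => k _; have := be_dec (ltnW (ltn_ord k)); have := al_ge0 k.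
by lra.
Qed.

Let Eprod n x := \prod_(i < n) Efactor i x.

Let Eprod_ge0 n x : -1 <= x <= 1 -> 0 <= Eprod n x.
Proof. by move=> xI; apply: prodr_ge0 => i _; exact: Efactor_ge0. Qed.

Let Eprod_cvg x : -1 <= x <= 1 -> Eprod ^~ x @ \oo --> limn (Eprod ^~ x).
Proof.
move=> xI; have [n0 hn0] := be_le2.
suff : cvgn (Eprod ^~ x) by [].
apply: (@near_nonincreasing_is_cvgn _ _ 0); last by near=> n; exact: Eprod_ge0.
exists n0 => // m /= n0m n mn.
elim: n mn => [|n ih]; first by rewrite leqn0 => /eqP ->.
rewrite leq_eqVlt => /predU1P[->//|]; rewrite ltnS => mn.
apply: le_trans (ih mn); rewrite /Eprod big_ord_recr/=.
rewrite ler_piMr ?Eprod_ge0// Efactor_le1// hn0//; exact: leq_trans n0m mn.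
Unshelve. all: by end_near. Qed.

Let Eprod_le : exists K, forall n x, -1 <= x <= 1 -> Eprod n x <= K.
Proof.
have [n0 hn0] := be_le2; pose K := 1 + be 0%N ^+ 2.
have K1 : 1 <= K by rewrite lerDl sqr_ge0.
exists (K ^+ n0) => n x xI.
(* Only the factors of index below [n0] cost a factor [K]; the later ones are at most 1. *)
apply: (@le_trans _ _ (K ^+ minn n n0)); last first.
  by rewrite ler_weXn2l// geq_minr.
elim: n => [|n ih]; first by rewrite min0n expr0 /Eprod big_ord0.
rewrite /Eprod big_ord_recr/= -/(Eprod n x).
have [nn0|n0n] := ltnP n n0.
  rewrite (minn_idPl nn0) exprSr ler_pM ?Eprod_ge0 ?Efactor_ge0 ?Efactor_le//.
  by move: ih; rewrite (minn_idPl (ltnW nn0)).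
rewrite (minn_idPr (leqW n0n)) -[leRHS]mulr1.
rewrite ler_pM ?Eprod_ge0 ?Efactor_ge0 ?Efactor_le1 ?hn0//.
by move: ih; rewrite (minn_idPr n0n).
Qed.

Let measurable_Efactor i : measurable_fun `[(-1 : R), 1] (Efactor i).
Proof.
apply: subspace_continuous_measurable_fun => //.
apply: continuous_subspace_itv => x; rewrite in_itv/= => xI.
have aff (c d : R) : continuous (fun x : R => c + d * x).
  move=> y; apply: cvgD; first exact: cvg_cst.
  by apply: cvgM; [exact: cvg_cst|exact: cvg_id].
(* Written as a quotient of affine functions of x, the factor is continuous wherever its denominator
   is nonzero. *)
have EfactorE : Efactor i = (fun x =>
    ((1 - be i + be i ^+ 2 / 2) + (be i - be i ^+ 2 / 2) * x) *
    ((1 + al i + al i ^+ 2 / 2) + (- al i - al i ^+ 2 / 2) * x)^-1).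
  by apply/funext => y; congr (_ / _); field.
have den0 : (1 + al i + al i ^+ 2 / 2) + (- al i - al i ^+ 2 / 2) * x != 0.
  have := den_ge1 i xI.
  have -> : 1 + al i * (1 - x) + al i ^+ 2 * (1 - x) / 2 =
    (1 + al i + al i ^+ 2 / 2) + (- al i - al i ^+ 2 / 2) * x by field.
  by move=> /(lt_le_trans ltr01)/gt_eqF ->.
rewrite EfactorE; apply: cvgM; first exact: aff.
by apply: cvgV => //; exact: aff.
Qed.

Lemma bmeas_Efun : bmeas (Efun al be de).
Proof.
apply: bmeasM.
  split.
    apply: measurableT_comp; first exact: measurable_expR.
    by apply: measurable_funM => //; exact: measurable_funB.
  exists (expR (`|gam al be de| * 2)) => x /andP[x1 x2].
  rewrite ger0_norm ?expR_ge0// ler_expR (le_trans (ler_norm _))//.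
  by rewrite normrM ler_wpM2l// ler_norml; apply/andP; split; lra.
split.
  apply: (@measurable_fun_cvg _ _ _ _ Eprod).
    by move=> n; apply: measurable_prod => i _; exact: measurable_Efactor.
  by move=> x; rewrite /= in_itv/=; exact: Eprod_cvg.
have [K hK] := Eprod_le; exists K => x xI.
have Ecvg := Eprod_cvg xI.
rewrite ger0_norm.
  by apply: (cvgr_to_le Ecvg); near=> n; exact: hK.
by apply: (cvgr_to_ge Ecvg); near=> n; exact: Eprod_ge0.
Unshelve. all: by end_near. Qed.

End Efun_bmeas.

(** * Determinants and dimensions *)
Section DetCombinatorics.
Context {R : realType}.

(** The cofactors along column [j0] do not see that column, so they may be taken from [B]; a
    determinant varying in one column thus becomes a linear form with fixed coefficients. *)
Lemma expand_det_col_eq (K : comPzRingType) (n : nat) (A B : 'M[K]_n) (j0 : 'I_n) :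
  (forall i j, j != j0 -> A i j = B i j) ->
  \det A = \sum_i A i j0 * cofactor B i j0.
Proof.
move=> AB; rewrite (expand_det_col _ j0); apply: eq_bigr => i _.
congr (_ * (_ * \det _)); apply/matrixP => i' j'; rewrite !mxE AB//.
by rewrite eq_sym neq_lift.
Qed.

Lemma normr_det_le (K : numDomainType) (n : nat) (A : 'M[K]_n) (b : 'I_n -> K) :
  (forall i j, `|A i j| <= b i) -> `|\det A| <= n`!%:R * \prod_i b i.
Proof.
move=> Ab; rewrite /determinant (le_trans (ler_norm_sum _ _ _))//.
apply: (@le_trans _ _ (\sum_(s : 'S_n) \prod_i b i)).
  apply: ler_sum => s _; rewrite normrM normrX normrN1 expr1n mul1r normr_prod.
  by apply: ler_prod => i _; rewrite normr_ge0 Ab.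
by rewrite sumr_const card_Sn mulr_natl.
Qed.

Lemma det_col_eq0 (K : comPzRingType) (n : nat) (A : 'M[K]_n) (j1 j2 : 'I_n) :
  j1 != j2 -> (forall i, A i j1 = A i j2) -> \det A = 0.
Proof.
move=> j12 Aj; rewrite -det_tr; apply: (determinant_alternate j12) => i.
by rewrite !mxE.
Qed.

Lemma sorted_gtn_codom (n : nat) (p : 'I_n -> nat) :
  (forall i j : 'I_n, (i < j)%N -> (p j < p i)%N) ->
  sorted gtn [seq p i | i <- enum 'I_n].
Proof.
move=> pdec; rewrite sorted_map.
have := iota_ltn_sorted 0 n; rewrite -val_enum_ord sorted_map.
by apply: sub_sorted => i j /=; exact: pdec.
Qed.

(** If p = q the matrix is the identity. If some p i is not a value of q, its row is zero. Otherwise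
    the values of p lie among those of q, and two strictly decreasing lists of the same length with
    this inclusion coincide. *)
Lemma det_eq_indicator (K : comPzRingType) (n : nat) (p q : 'I_n -> nat) :
  (forall i j : 'I_n, (i < j)%N -> (p j < p i)%N) ->
  (forall i j : 'I_n, (i < j)%N -> (q j < q i)%N) ->
  \det (\matrix_(i, j) (p i == q j)%:R) = [forall i, p i == q i]%:R :> K.
Proof.
move=> pdec qdec.
have qinj : injective q.
  move=> i j qij; have [/qdec|/qdec|/val_inj//] := ltngtP i j;
  by rewrite qij ltnn.
have [/forallP pq|pq] := boolP [forall i, p i == q i].
  rewrite (_ : \matrix_(i, j) _ = 1%:M) ?det1//.
  by apply/matrixP => i j; rewrite !mxE (eqP (pq i)) (inj_eq qinj).
have [/forallP psub|] := boolP [forall i, [exists j, p i == q j]]; last first.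
  rewrite negb_forall => /existsP[i]; rewrite negb_exists => /forallP pi.
  rewrite (expand_det_row _ i) big1// => j _; rewrite mxE.
  by rewrite (negbTE (pi j)) mul0r.
case/negP: pq; apply/forallP => i; apply/eqP.
have gtn_trans : transitive gtn by move=> a b c /= h1 h2; exact: ltn_trans h2 h1.
have gtn_irr : irreflexive gtn by move=> a /=; rewrite ltnn.
have sp := sorted_gtn_codom pdec; have sq := sorted_gtn_codom qdec.
have sub : {subset [seq p i | i <- enum 'I_n] <= [seq q i | i <- enum 'I_n]}.
  move=> _ /mapP[j _ ->]; have /existsP[k /eqP ->] := psub j.
  by apply/map_f; rewrite mem_enum.
have [_ pq] := uniq_min_size (sorted_uniq gtn_trans gtn_irr sp) sub
  (eq_leq (etrans (size_map _ _) (esym (size_map _ _)))).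
have /eq_in_map := irr_sorted_eq gtn_trans gtn_irr sp sq pq.
by apply; rewrite mem_enum.
Qed.

Lemma shifted_dec (N : nat) (lam : 'I_N -> nat) : nonincr lam ->
  forall i j : 'I_N, (i < j)%N -> (shifted lam j < shifted lam i)%N.
Proof.
move=> /forallP lam_dec i j ij; rewrite /shifted.
have /implyP := forallP (lam_dec i) j; move=> /(_ (ltnW ij)).
by have := ltn_ord j; lia.
Qed.

Lemma shifted_inj (N : nat) (lam mu : 'I_N -> nat) :
  [forall i, shifted lam i == shifted mu i] = [forall i, lam i == mu i].
Proof.
by apply: eq_forallb => i; rewrite /shifted eqn_add2r.
Qed.

Lemma psum_indicator (N : nat) (c : ('I_N -> nat) -> R) (lam : 'I_N -> nat) (M : nat) :
  nonincr lam -> (forall i, lam i <= M)%N ->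
  psum M (fun mu => c mu * [forall i, mu i == lam i]%:R) = c lam.
Proof.
move=> lam_dec lamM; pose l0 := [ffun i => inord (lam i)] : {ffun 'I_N -> 'I_M.+1}.
have l0E : (fun i => nat_of_ord (l0 i)) = lam.
  by apply/funext => i; rewrite ffunE inordK// ltnS.
rewrite /psum (bigD1 l0) ?l0E//.
have -> : [forall i, (l0 i : nat) == lam i] = true.
  by apply/forallP => i; rewrite ffunE inordK// ltnS.
rewrite /= mulr1 big1 ?addr0// => l /andP[_ ll0].
have [/forallP llam|] := boolP [forall i, (l i : nat) == lam i]; last by rewrite mulr0.
case/negP: ll0; apply/eqP/ffunP => i; apply/val_inj.
by rewrite /= ffunE inordK ?ltnS// (eqP (llam i)).
Qed.

(** Up to reversing the rows this is the Vandermonde determinant of the points 2 [ze j]. *)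
Lemma charden_neq0 (N : nat) (ze : 'I_N -> R) : injective ze -> charden ze != 0.
Proof.
move=> zinj; rewrite /charden.
pose V := Vandermonde N (\row_j (2 * ze j)).
rewrite (_ : \matrix_(i, j) _ = row_perm (perm (@rev_ord_inj N)) V); last first.
  apply/matrixP => i j; rewrite !mxE permE/=; congr (_ ^+ _).
  by have := ltn_ord i; lia.
rewrite row_permE det_mulmx det_perm mulf_neq0 ?signr_eq0//.
rewrite det_Vandermonde; apply/prodf_neq0 => i _; apply/prodf_neq0 => j ij.
rewrite !mxE -mulrBr mulf_neq0 ?pnatr_eq0// subr_eq0; apply/eqP => /zinj ji.
by move: ij; rewrite ji ltnn.
Qed.

Lemma prod_exp_rev (x : R) (N : nat) :
  \prod_(i < N) x ^+ (N - 1 - i) = x ^+ ((N.-1 * N) %/ 2).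
Proof.
rewrite prodrXr; congr (_ ^+ _).
rewrite (reindex_inj rev_ord_inj)/=.
rewrite (eq_bigr (fun i : 'I_N => nat_of_ord i)); last first.
  by move=> i _; have := ltn_ord i; lia.
by rewrite -(big_mkord xpredT id) bin2_sum bin2 divn2 mulnC.
Qed.

(** After factoring both differences of squares, adding [di] and [dj] can only enlarge the
    difference and the sum. *)
Lemma ge1_quotient_sqr (di dj mi mj : R) : 0 <= mj -> mj < mi -> 0 <= dj -> dj <= di ->
  1 <= ((di + mi) ^+ 2 - (dj + mj) ^+ 2) / (mi ^+ 2 - mj ^+ 2).
Proof.
move=> mj0 mji dj0 dji.
have m0 : 0 < mi ^+ 2 - mj ^+ 2 by rewrite subr_sqr mulr_gt0//; lra.
rewrite ler_pdivlMr// mul1r !subr_sqr ler_pM ?subr_ge0 ?addr_ge0//; lra.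
Qed.

Lemma prodr_ge1 (I : Type) (s : seq I) (P : pred I) (F : I -> R) :
  (forall i, P i -> 1 <= F i) -> 1 <= \prod_(i <- s | P i) F i.
Proof.
move=> F1; elim/big_ind: _ => // x y x1 y1.
by rewrite -[1]mulr1 ler_pM.
Qed.

Lemma nonincr_le (N : nat) (lam : 'I_N -> nat) (i j : 'I_N) : nonincr lam -> (i < j)%N ->
  (lam j)%:R <= (lam i)%:R :> R.
Proof.
by move=> /forallP/(_ i)/forallP/(_ j)/implyP h ij; rewrite ler_nat h// ltnW.
Qed.

Lemma dimSOeven_ge1 (N : nat) (lam : 'I_N -> nat) :
  nonincr lam -> 1 <= dimSOeven R lam.
Proof.
move=> lam_dec; rewrite /dimSOeven; apply: prodr_ge1 => i _.
apply: prodr_ge1 => j ij; apply: ge1_quotient_sqr => //.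
- by rewrite ltr_nat; have := ltn_ord j; lia.
- exact: nonincr_le.
Qed.

(** The left-hand factors are 2 l_i, and m_i is at most N - i, so 2 l_i is at most 2 (N - i) l_i /
    m_i; the product over pairs is at least 1. The left side is the bound for a product of values of
    [Jp]. *)
Lemma dimSOodd_ge (N : nat) (lam : 'I_N -> nat) : nonincr lam ->
  \prod_(i < N) (2 * shifted lam i + 1)%:R <= \prod_(i < N) (2 * (N - i)%:R) * dimSOodd R lam.
Proof.
move=> lam_dec; rewrite /dimSOodd mulrCA -big_split/=.
set V := \prod_i \prod_(j < N | _) _.
have V1 : 1 <= V.
  apply: prodr_ge1 => i _; apply: prodr_ge1 => j ij.
  rewrite -!(addrA (lam _)%:R); apply: ge1_quotient_sqr => //.
  - have : (1 <= N - j)%N by have := ltn_ord j; lia.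
    by rewrite -(ler_nat R); lra.
  - by rewrite ltrD2r ltr_nat; have := ltn_ord j; lia.
  - exact: nonincr_le.
have h i : (2 * shifted lam i + 1)%:R <= 2 * (N - i)%:R *
    (((lam i)%:R + (N - i)%:R - 2^-1) / ((N - i)%:R - 2^-1)) :> R.
  have Ni : (1 <= N - i)%N by have := ltn_ord i; lia.
  have -> : (2 * shifted lam i + 1)%:R = 2 * ((lam i)%:R + (N - i)%:R - 2^-1) :> R.
    rewrite /shifted (_ : N - 1 - i = (N - i).-1)%N; last by lia.
    by rewrite -{2}(prednK Ni) -natr1 natrD natrM natrD; field.
  have : (1 : R) <= (N - i)%:R by rewrite (ler_nat R 1).
  move: (N - i)%:R (lam i)%:R (ler0n R (lam i)) => m l l0 m1.
  rewrite mulrA ler_pdivlMr; last by lra.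
  by nra.
rewrite -[leLHS]mul1r ler_pM ?prodr_ge0//.
by apply: ler_prod => i _; rewrite ler0n h.
Qed.

End DetCombinatorics.

(** * Column-wise integration of a determinantal series *)
Section DetMoments.
Context {R : realType} (N : nat).
Implicit Types (ze : 'I_N -> R).
Local Open Scope classical_set_scope.

(** Only column [j0] depends on x and the determinant is linear in it, so integration acts on that
    column alone. *)
Lemma arcsine_integral_det (h : 'I_N -> R -> R) (u : R -> R) (A : R -> 'M[R]_N)
    (B : 'M[R]_N) (j0 : 'I_N) :
  (forall i, bmeas (h i)) -> bmeas u ->
  (forall x i, A x i j0 = h i x) ->
  (forall x i j, j != j0 -> A x i j = B i j) ->
  (forall i, B i j0 = arcsine_integral (fun x => h i x * u x)) ->
  bmeas (fun x => \det (A x)) /\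
  arcsine_integral (fun x => \det (A x) * u x) = \det B.
Proof.
move=> bh bu Ah AB Bh.
have detE x : \det (A x) = \sum_i h i x * cofactor B i j0.
  rewrite (expand_det_col_eq (AB x)); apply: eq_bigr => i _; by rewrite Ah.
have bhc i : bmeas (fun x => h i x * cofactor B i j0).
  by apply: bmeasM => //; exact: bmeas_cst.
split.
  rewrite (_ : (fun x => \det (A x)) = fun x => \sum_i h i x * cofactor B i j0).
    exact: bmeas_sum.
  exact/funext.
rewrite (@eq_arcsine_integral _ _
  (fun x => \sum_i cofactor B i j0 * (h i x * u x))); last first.
  by move=> x _; rewrite detE mulr_suml; apply: eq_bigr => i _; ring.
rewrite arcsine_integral_sum; last first.
  by move=> i; apply: bmeasM; [exact: bmeas_cst|exact: bmeasM].
rewrite (expand_det_col _ j0); apply: eq_bigr => i _.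
by rewrite arcsine_integralZ ?Bh 1?mulrC//; exact: bmeasM.
Qed.

(** Here [v] stands for the J_k, [g] for the rows of the right-hand determinant and [u] for the test
    functions. The same [b] bounds the values and the moments of [v], so one series dominates every
    mixture of evaluated and integrated columns. *)
Variables (v : nat -> R -> R) (b : nat -> R) (g u : 'I_N -> R -> R).
Variables (c : ('I_N -> nat) -> R) (C : R).
Hypothesis bmeas_v : forall s, bmeas (v s).
Hypothesis bmeas_g : forall i, bmeas (g i).
Hypothesis bmeas_u : forall j, bmeas (u j).
Hypothesis v_le : forall s x, `|v s x| <= b s.
Hypothesis vu_le : forall s j, `|arcsine_integral (fun x => v s x * u j x)| <= b s.
Hypothesis c_le : forall M, psum M (fun lam => `|c lam| * \prod_i b (shifted lam i)) <= C.
Hypothesis eval_cvg : forall ze, (forall j, -1 <= ze j <= 1) ->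
  psum M (fun lam => c lam * \det (\matrix_(i, j) v (shifted lam i) (ze j)))
    @[M --> \oo] --> \det (\matrix_(i, j) g i (ze j)).

(* Column j carries the moment against u j when j < r, and evaluation at ze j
   otherwise; the moments are introduced one column at a time. *)
Let col (r : nat) ze (h : R -> R) (j : 'I_N) : R :=
  if (j < r)%N then arcsine_integral (fun x => h x * u j x) else h (ze j).

Let colmx r ze (h : 'I_N -> R -> R) : 'M[R]_N := \matrix_(i, j) col r ze (h i) j.

Let subst (j0 : 'I_N) ze x : 'I_N -> R := fun j => if j == j0 then x else ze j.

(** Column [j0] is the first one still evaluated; integrating over its point moves the threshold to
    [j0.+1]. *)
Let colmx_subst ze (h : 'I_N -> R -> R) (j0 : 'I_N) : (forall i, bmeas (h i)) ->
  bmeas (fun x => \det (colmx j0 (subst j0 ze x) h)) /\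
  arcsine_integral (fun x => \det (colmx j0 (subst j0 ze x) h) * u j0 x) =
  \det (colmx j0.+1 ze h).
Proof.
move=> bh; apply: (@arcsine_integral_det h _ _ _ j0) => //.
- by move=> x i; rewrite mxE /col ltnn /subst eqxx.
- move=> x i j jj0; rewrite !mxE /col /subst (negbTE jj0) ltnS.
  by rewrite [in RHS]leq_eqVlt (_ : (j == j0 :> nat) = false)//; exact/negbTE.
- by move=> i; rewrite mxE /col ltnSn.
Qed.

Let colmx_cvg r ze : (r <= N)%N -> (forall j, -1 <= ze j <= 1) ->
  psum M (fun lam => c lam * \det (colmx r ze (fun i => v (shifted lam i))))
    @[M --> \oo] --> \det (colmx r ze g).
Proof.
elim: r ze => [|r ih] ze rN zeI; first exact: eval_cvg.
pose j0 := Ordinal rN.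
pose F M x := psum M (fun lam => c lam *
  \det (colmx j0 (subst j0 ze x) (fun i => v (shifted lam i)))) * u j0 x.
have bF M : bmeas (F M).
  apply: bmeasM => //; apply: bmeas_sum => l; apply: bmeasM; first exact: bmeas_cst.
  by apply: (colmx_subst _ _ _).1.
have FE M : arcsine_integral (F M) = psum M (fun lam => c lam *
    \det (colmx r.+1 ze (fun i => v (shifted lam i)))).
  rewrite (@eq_arcsine_integral _ _ (fun x => \sum_(l : {ffun 'I_N -> 'I_M.+1} |
    nonincr (fun i => nat_of_ord (l i))) c (fun i => nat_of_ord (l i)) *
    (\det (colmx j0 (subst j0 ze x) (fun i => v (shifted (fun i => nat_of_ord (l i)) i)))
      * u j0 x))); last first.
    by move=> x _; rewrite /F /psum mulr_suml; apply: eq_bigr => l _; rewrite mulrA.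
  have bl (l : {ffun 'I_N -> 'I_M.+1}) := colmx_subst ze j0
    (fun i => bmeas_v (shifted (fun i => nat_of_ord (l i)) i)).
  rewrite arcsine_integral_sum; last first.
    move=> l; apply: bmeasM; first exact: bmeas_cst.
    by apply: bmeasM => //; exact: (bl l).1.
  apply: eq_bigr => l _; rewrite arcsine_integralZ ?(bl l).2//.
  by apply: bmeasM => //; exact: (bl l).1.
have [bg gE] := colmx_subst ze j0 bmeas_g.
rewrite -gE; under eq_fun do rewrite -FE.
have [_ [K uK]] := bmeas_u j0.
have substI x : -1 <= x <= 1 -> forall j, -1 <= subst j0 ze x j <= 1.
  by move=> xI j; rewrite /subst; case: ifP.
(* The partial sums are at most N! C by the row-wise bound on determinants, and [K] bounds
   [u j0]. *)
apply: (@arcsine_integral_cvg _ _ _ (N`!%:R * C * K)) => //.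
- exact: bmeasM.
- by move=> x xI; apply: cvgM; [apply: ih (ltnW rN) (substI x xI)|exact: cvg_cst].
move=> M x xI; rewrite normrM ler_pM ?uK//.
apply: (@le_trans _ _ (N`!%:R * psum M (fun lam => `|c lam| * \prod_i b (shifted lam i)))).
  rewrite /psum mulr_sumr (le_trans (ler_norm_sum _ _ _))//.
  apply: ler_sum => l _; rewrite normrM mulrCA ler_wpM2l//.
  apply: normr_det_le => i j; rewrite mxE /col; case: ifP => _; [exact: vu_le|exact: v_le].
by rewrite ler_wpM2l.
Qed.

Lemma det_moments_cvg :
  psum M (fun lam => c lam *
      \det (\matrix_(i, j) arcsine_integral (fun x => v (shifted lam i) x * u j x)))
    @[M --> \oo] -->
  \det (\matrix_(i, j) arcsine_integral (fun x => g i x * u j x)).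
Proof.
(* At r = N no column is evaluated any more, so the point 0 is a dummy that only has to lie in
   [-1, 1]. *)
have colE h : colmx N (fun=> 0) h =
    \matrix_(i, j) arcsine_integral (fun x => h i x * u j x).
  by apply/matrixP => i j; rewrite !mxE /col ltn_ord.
rewrite -colE; under eq_fun do under eq_fun do rewrite -colE.
by apply: colmx_cvg => // j; rewrite lerN10 ler01.
Qed.

End DetMoments.

(** * The determinantal form of the defining identity *)
Section Identity.
Context {R : realType} (N : nat) (al be : nat -> R) (de a : R).
Implicit Types (lam : 'I_N -> nat) (ze : 'I_N -> R).
Local Open Scope classical_set_scope.

(** In the even case 2^N comes from the factor 2 in the entries of the numerator, and the division
    by 2 from the normalisation by twice the dimension. *)
Definition char_scale : R := if a == 2^-1 then 1 else 2 ^+ N / 2.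

Definition Jac_bound (s : nat) : R := if a == 2^-1 then (2 * s + 1)%:R else 1.

Lemma dimSO_gt0 lam : nonincr lam -> 0 < dimSO a lam.
Proof.
move=> lam_dec; rewrite /dimSO; case: ifP => _; last first.
  exact: lt_le_trans ltr01 (dimSOeven_ge1 lam_dec).
rewrite ltNge; apply/negP => d0; have := dimSOodd_ge (R := R) lam_dec.
apply/negP; rewrite -ltNge; apply: (@le_lt_trans _ _ 0).
  by rewrite mulr_ge0_le0// prodr_ge0// => i _; rewrite mulr_ge0.
by apply: prodr_gt0 => i _; rewrite ltr0n addn1.
Qed.

(** This lets the dimension dividing [Pcoef] absorb the growth of the determinant. For the even case
    the left side is 1 and both factors on the right are at least 1. *)
Lemma prod_Jac_bound_le lam : nonincr lam ->
  \prod_i Jac_bound (shifted lam i) <= \prod_(i < N) (2 * (N - i)%:R) * dimSO a lam.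
Proof.
move=> lam_dec; rewrite /Jac_bound /dimSO.
case: (a == 2^-1); first exact: dimSOodd_ge.
rewrite big1// -[leLHS]mulr1 ler_pM//; last exact: dimSOeven_ge1.
apply: prodr_ge1 => i _; have : (1 : R) <= (N - i)%:R.
  by rewrite (ler_nat R 1); have := ltn_ord i; lia.
by lra.
Qed.

Lemma normchar_charden lam ze : charden ze != 0 ->
  normchar a lam ze * charden ze = char_scale / dimSO a lam *
    \det (\matrix_(i < N, j < N) Jac a (shifted lam i) (ze j)).
Proof.
move=> den0; rewrite /normchar /char_scale /dimSO /Jac.
case: (a == 2^-1); rewrite ?/chiSOodd ?/XSOeven.
  by rewrite mulrAC divfK// mul1r mulrC.
rewrite (_ : \matrix_(i, j) _ = 2 *: \matrix_(i, j) Jm (shifted lam i) (ze j)).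
  by rewrite detZ mulrAC divfK// invfM; ring.
by apply/matrixP => i j; rewrite !mxE.
Qed.

Definition Pcoef (P : ('I_N -> nat) -> R) lam : R := P lam * (char_scale / dimSO a lam).

Definition Emoment (i : 'I_N) (x : R) : R := (2 * x) ^+ (N - 1 - i) * Efun al be de x.

Lemma is_P_det_cvg P ze : is_P a al be de P -> (forall j, -1 <= ze j <= 1) ->
  psum M (fun lam => Pcoef P lam * \det (\matrix_(i, j) Jac a (shifted lam i) (ze j)))
    @[M --> \oo] --> \det (\matrix_(i, j) Emoment i (ze j)).
Proof.
move=> [_ [_ hP]] zeI.
have [/injectiveP zinj|] := boolP (injectiveb ze); last first.
  (* Two equal points give two equal columns on both sides, so every partial sum and the limit are
     0. *)
  move=> /injectivePn[j1 [j2 j12 zej]].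
  rewrite (det_col_eq0 j12); last by move=> i; rewrite !mxE zej.
  under eq_fun => M.
    rewrite /psum big1; last first.
      move=> l _; rewrite (det_col_eq0 j12) ?mulr0// => i; by rewrite !mxE zej.
    over.
  exact: cvg_cst.
have den0 := charden_neq0 zinj.
have -> : \det (\matrix_(i, j) Emoment i (ze j)) =
    \prod_j Efun al be de (ze j) * charden ze.
  rewrite (_ : \prod_j _ = \det (diag_mx (\row_j Efun al be de (ze j)))); last first.
    by rewrite det_diag; apply: eq_bigr => j _; rewrite mxE.
  rewrite mulrC /charden -det_mulmx; congr (\det _); apply/matrixP => i j.
  by rewrite mul_mx_diag !mxE.
under eq_fun => M.
  have -> : psum M (fun lam => Pcoef P lam *
      \det (\matrix_(i, j) Jac a (shifted lam i) (ze j))) =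
    psum M (fun lam => P lam * normchar a lam ze) * charden ze.
    rewrite /psum mulr_suml; apply: eq_bigr => l _.
    by rewrite -[RHS]mulrA normchar_charden// mulrA.
  over.
by apply: cvgM; [exact: hP|exact: cvg_cst].
Qed.

(** The dimensions cancel and leave a constant times the partial sums of P, which converge and are
    therefore bounded. *)
Lemma Pcoef_bounded P : is_P a al be de P -> exists C, forall M,
  psum M (fun lam => `|Pcoef P lam| * \prod_i Jac_bound (shifted lam i)) <= C.
Proof.
move=> [P0 [Pcvg _]].
have [C hC] : exists C, forall M, psum M P <= C.
  have /cvg_seq_bounded/bounded_fun_has_ubound[C hC] : cvgn (fun M => psum M P).
    by apply/cvg_ex; exists 1.
  by exists C => M; apply: hC; exists M.
have s0 : 0 <= char_scale.
  by rewrite /char_scale; case: ifP => // _; rewrite divr_ge0 ?exprn_ge0.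
pose K := char_scale * \prod_(i < N) (2 * (N - i)%:R).
have K0 : 0 <= K by rewrite mulr_ge0// prodr_ge0// => i _; rewrite mulr_ge0.
exists (K * C) => M; apply: (@le_trans _ _ (K * psum M P)); last by rewrite ler_wpM2l.
rewrite /psum mulr_sumr; apply: ler_sum => l l_dec.
move: (fun i => nat_of_ord (l i)) l_dec => lam lam_dec.
have d0 := dimSO_gt0 lam_dec.
rewrite /Pcoef ger0_norm; last by rewrite mulr_ge0 ?P0// divr_ge0// ltW.
apply: (@le_trans _ _ (P lam * (char_scale / dimSO a lam) *
    (\prod_(i < N) (2 * (N - i)%:R) * dimSO a lam))).
  rewrite ler_wpM2l ?prod_Jac_bound_le//.
  by rewrite mulr_ge0 ?P0// divr_ge0// ltW.
rewrite le_eqVlt; apply/orP; left; apply/eqP; rewrite /K.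
move: (\prod_(_ < _) _) (gt_eqF d0) => Q /negbT dn0; by field.
Qed.

(** Homogeneity of the functionals pulls 2^(N-1-i) out of row i. *)
Lemma det_Emoment (h : 'I_N -> (R -> R) -> R) :
  (forall j (s : R) f, bmeas f -> h j (fun x => s * f x) = s * h j f) ->
  in_Omega al be de ->
  \det (\matrix_(i, j) h j (Emoment i)) = 2 ^+ ((N.-1 * N) %/ 2) *
  \det (\matrix_(i, j) h j (fun x => x ^+ (N - 1 - i) * Efun al be de x)).
Proof.
move=> hZ omega.
rewrite -prod_exp_rev.
rewrite (_ : \matrix_(i, j) h j (Emoment i) = diag_mx (\row_(i < N) 2 ^+ (N - 1 - i)) *m
  \matrix_(i, j) h j (fun x => x ^+ (N - 1 - i) * Efun al be de x)); last first.
  apply/matrixP => i j; rewrite mul_diag_mx !mxE -hZ.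
    by congr (h j); apply/funext => x; rewrite /Emoment exprMn mulrA.
  by apply: bmeasM; [exact/bmeasX/bmeas_id|exact: bmeas_Efun].
rewrite det_mulmx det_diag; congr (_ * _).
by apply: eq_bigr => i _; rewrite mxE.
Qed.

Lemma CNaE : (1 <= N)%N -> 2 ^+ ((N.-1 * N) %/ 2) = CNa a N * char_scale.
Proof.
move=> N1; rewrite /CNa /char_scale; case: (a == 2^-1); first by rewrite mulr1 natrX.
case: N N1 => // n _; rewrite /= natrX !subSS exprS.
(* With N = n + 1 the scale 2^N / 2 equals 2^n, which accounts for the gap between the two
   triangular exponents. *)
have -> : ((n * n.+1) %/ 2 = ((n - 1) * n) %/ 2 + n)%N.
  case: n => // n; rewrite subSS subn0.
  have -> : (n.+1 * n.+2 = n.+1 * 2 + n * n.+1)%N by lia.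
  by rewrite divnMDl// addnC.
by rewrite exprD; field.
Qed.

End Identity.

(** * Reading off one coefficient by orthogonality *)

Theorem theorem2p8 (R : realType) (al be : nat -> R) (de : R) (N : nat) (a : R)
  (P : ('I_N -> nat) -> R) :
  in_Omega al be de -> (1 <= N)%N -> (a = 2^-1 \/ a = - 2^-1) ->
  is_P a al be de P ->
  forall lam : 'I_N -> nat, nonincr lam ->
    P lam = CNa a N *
            \det (\matrix_(i < N, j < N) fj a al be de j (shifted lam i)) *
            dimSO a lam.
Proof.
move=> omega N1 ha hP lam lam_dec.
(* Each [u j] is dual to J at [shifted lam j], so the moment matrix of any [mu] has entries 0 or
   1. *)
pose u (j : 'I_N) (x : R) := Wt a (shifted lam j) / pi *
  (Jac a (shifted lam j) x * weight_poly a x).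
have bu j : bmeas (u j).
  apply: bmeasM; first exact: bmeas_cst.
  by apply: bmeasM; [exact: bmeas_Jac|exact: bmeas_weight_poly].
have bE i : bmeas (@Emoment R N al be de i).
  apply: bmeasM; last exact: bmeas_Efun.
  by apply: bmeasX; apply: bmeasM; [exact: bmeas_cst|exact: bmeas_id].
have Jac_bound_ge1 s : 1 <= Jac_bound a s.
  by rewrite /Jac_bound; case: ifP => // _; rewrite (ler_nat R 1) addn1.
have uE s j : arcsine_integral (fun x => Jac a s x * u j x) = (s == shifted lam j)%:R.
  exact: Jac_orthonormal.
have Ju_le s j : `|arcsine_integral (fun x => Jac a s x * u j x)| <= Jac_bound a s.
  by rewrite uE; apply: le_trans (Jac_bound_ge1 s); rewrite normr_nat; case: eqP.
have [C hC] := Pcoef_bounded hP.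
have := @det_moments_cvg R N (Jac a) (Jac_bound a) (@Emoment R N al be de) u (Pcoef a P) C
  (bmeas_Jac a) bE bu (fun s x => Jac_le a x s) Ju_le hC (fun ze => is_P_det_cvg hP).
rewrite (@det_Emoment _ _ al be de (fun j f => arcsine_integral (fun x => f x * u j x))); last 2 first.
- move=> j s f bf; rewrite -arcsine_integralZ; last exact: bmeasM.
  by congr arcsine_integral; apply/funext => x; rewrite mulrA.
- exact: omega.
have -> : \det (\matrix_(i, j) arcsine_integral
    (fun x => x ^+ (N - 1 - i) * Efun al be de x * u j x)) =
  \det (\matrix_(i < N, j < N) fj a al be de j (shifted lam i)).
  (* The moment matrix has powers of x along its rows and parts of [lam] along its columns, the
     transpose of the matrix of the [fj]. *)
  rewrite -det_tr; congr (\det _); apply/matrixP => i j; rewrite !mxE.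
  rewrite (@eq_arcsine_integral _ _ (fun x => Wt a (shifted lam i) / pi *
    (x ^+ (N - 1 - j) * Efun al be de x *
      (Jac a (shifted lam i) x * weight_poly a x)))); last first.
    by move=> x _; rewrite /u mulrCA.
  rewrite arcsine_integralZ; last first.
    apply: bmeasM; first by apply: bmeasM; [exact/bmeasX/bmeas_id|exact: bmeas_Efun].
    by apply: bmeasM; [exact: bmeas_Jac|exact: bmeas_weight_poly].
  rewrite /fj; congr (_ * _); rewrite /arcsine_integral.
  rewrite set_mem_set.
  apply: eq_Rintegral => x; rewrite inE/= in_itv/= => xI.
  by rewrite -[RHS]mulrA weight_polyE// !mulrA.
move=> cvg_det; have cvg_c : (psum M (fun mu => Pcoef a P mu *
      \det (\matrix_(i, j) arcsine_integral (fun x => Jac a (shifted mu i) x * u j x)))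
    @[M --> \oo] --> Pcoef a P lam)%classic.
  (* Once M reaches the largest part of [lam], exactly one index of the sum, [lam] itself, has a
     nonzero determinant, so the partial sums are eventually constant. *)
  apply: cvg_near_cst; near=> M.
  rewrite -(@psum_indicator _ _ (Pcoef a P) lam M lam_dec); last first.
    move=> i; apply: (@leq_trans (\max_j lam j)); first exact: leq_bigmax.
    by near: M; exact: nbhs_infty_ge.
  apply: eq_bigr => l l_dec; congr (_ * _).
  rewrite -shifted_inj -(det_eq_indicator R); last 2 first.
  - exact: shifted_dec.
  - exact: shifted_dec.
  by congr (\det _); apply/matrixP => i j; rewrite !mxE uE.
have := cvg_unique (@Rhausdorff R) cvg_c cvg_det; rewrite (CNaE a N1) /Pcoef => PE.
have d0 : dimSO a lam != 0 by rewrite gt_eqF// dimSO_gt0.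
have s0 : char_scale N a != 0.
  by rewrite /char_scale; case: ifP => // _; rewrite mulf_neq0 ?expf_neq0// invr_neq0.
move: (\det _) PE => D PE; apply: (mulIf s0); apply: (mulIf (invr_neq0 d0)).
rewrite -[LHS]mulrA PE; by field.
Unshelve. all: by end_near. Qed.
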